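(* Let $\Omega$ be a convex domain in $\mathbb{R}^n$, let $\tau$ be a smooth symmetric $(0,2)$-tensor field on $\Omega$, and let $x_0\neq y_0$ be points of $\Omega$. Let $e_1,\dots,e_n$ be an orthonormal frame of $\mathbb{R}^n$ with $e_n=N(x_0,y_0)$, and let $\tilde E_i=(e_i,-e_i)\in\mathbb{R}^n\times\mathbb{R}^n$ for $i=1,\dots,n$. Then $$\nabla_{\tilde E_i}E_\tau(x_0,y_0)=E_{\nabla_{e_i}\tau}(x_0,y_0)-\frac{2}{r(x_0,y_0)}\int_0^{r(x_0,y_0)}(s\,\tau_{nn;i}+2\tau_{in})(\theta(s,x_0,y_0))\,ds\quad\text{for } i<n,$$ and $$\nabla_{\tilde E_n}E_\tau(x_0,y_0)=E_{\nabla_{e_n}\tau}(x_0,y_0)-2\tau_{nn}(y_0).$$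
   Context: For $x,y\in\mathbb{R}^n$ let $r(x,y)=\|x-y\|$, and for $x\neq y$ let $N(x,y)=\frac{y-x}{\|y-x\|}$ and $\theta(s,x,y)=x+sN(x,y)$. For a symmetric $(0,2)$-tensor field $\tau$ on $\Omega$, $E_\tau(x,y)=\int_0^{r(x,y)}\tau(\theta(s,x,y))(N(x,y),N(x,y))\,ds$, viewed as a function of $(x,y)\in\Omega\times\Omega$; $\nabla_{V}$ for $V\in\mathbb{R}^n\times\mathbb{R}^n$ denotes the directional derivative of a function of $(x,y)$ in direction $V$. Components are taken in the frame $e_1,\dots,e_n$: $\tau_{ij}=\tau(e_i,e_j)$ and $\tau_{ij;k}=(\nabla_{e_k}\tau)(e_i,e_j)$; $\nabla_{e_i}\tau$ is the covariant derivative of $\tau$ in direction $e_i$. *)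

(* Defs.v *)
From HB Require Import structures.
From mathcomp Require Import all_boot all_order all_algebra.
From mathcomp Require Import all_classical all_reals all_analysis.
Set Implicit Arguments. Unset Strict Implicit. Unset Printing Implicit Defensive.
Import Order.TTheory GRing.Theory Num.Theory.
Import numFieldNormedType.Exports.
Local Open Scope classical_set_scope.
Local Open Scope ring_scope.

Section Defs.
Variables (R : realType) (n : nat).
Local Notation V := 'rV[R]_n.

Definition dotp (u w : V) : R := \sum_(k < n) u 0 k * w 0 k.
Definition enorm (u : V) : R := Num.sqrt (dotp u u).

Definition rdist (x y : V) : R := enorm (x - y).
Definition Nvec (x y : V) : V := (enorm (y - x))^-1 *: (y - x).
Definition theta (s : R) (x y : V) : V := x + s *: Nvec x y.

(** A (0,2)-tensor field on R^n, given by its components in the standard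
    basis: tau i j p = tau_p(E_i, E_j). *)
Definition tensor_field := 'I_n -> 'I_n -> V -> R.

Definition tapp (tau : tensor_field) (p u w : V) : R :=
  \sum_(i < n) \sum_(j < n) u 0 i * w 0 j * tau i j p.

(** Covariant derivative in the flat space R^n: (nabla_e tau) has components
    the directional derivatives of the components of tau. *)
Definition covD (e : V) (tau : tensor_field) : tensor_field :=
  fun i j p => 'D_e (tau i j) p.

Definition Etau (tau : tensor_field) (xy : V * V) : R :=
  let x := xy.1 in let y := xy.2 in
  Rintegral (@lebesgue_measure R) `[0, rdist x y]
    (fun s => tapp tau (theta s x y) (Nvec x y) (Nvec x y)).

Definition iterD (vs : seq V) (f : V -> R) : V -> R :=
  foldr (fun v g => 'D_v g) f vs.

Definition smooth_on (Omega : set V) (f : V -> R) : Prop :=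
  forall vs : seq V, forall x, Omega x ->
    {for x, continuous (iterD vs f)} /\ (forall v : V, derivable (iterD vs f) x v).

Definition convex_set (Omega : set V) : Prop :=
  forall x y, Omega x -> Omega y -> forall t : R, 0 <= t <= 1 ->
    Omega ((1 - t) *: x + t *: y).

Definition convex_domain (Omega : set V) : Prop :=
  [/\ open Omega, connected Omega, Omega !=set0 & convex_set Omega].

End Defs.

(* Main.v *)
Require Import Defs.
From HB Require Import structures.
From mathcomp Require Import all_boot all_order all_algebra.
From mathcomp Require Import all_classical all_reals all_analysis.
From mathcomp Require Import ring.
Import Order.TTheory GRing.Theory Num.Theory.
Import numFieldNormedType.Exports.
Local Open Scope classical_set_scope.
Local Open Scope ring_scope.

(** Rescaling the parameter to [0, 1] gives, with D = y - x,
      E_tau(x, y) = |D|^-1 * int_0^1 tau(x + t D)(D, D) dt.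
    Along (x + h v, y - h v) the base point x + t D moves in the fixed direction
    v with speed 1 - 2 t, while D changes by - 2 h v.  So only derivatives of tau
    along v occur, and since Omega is convex and open they are bounded near
    h = 0.  Differentiating under the integral sign and scaling back yields, for
    every v,
      E_{nabla_v tau} - (2/r) int_0^r (s tau_{NN;v} + 2 tau_{vN}) ds
        + (2/r) <N, v> E_tau.
    The last term vanishes for v = e_i with i < n; for v = N the integrals
    combine into that of the derivative of s tau_{NN}. *)

(** * Derivatives along straight lines *)

Lemma is_derive_line {R : realType} {V W : normedModType R} {f : V -> W}
    {p v : V} {a : R} {l : W} :
  is_derive (p + a *: v) v f l <->
  is_derive a 1 (fun h : R => f (p + h *: v)) l.
Proof.
(* The two difference quotients are the same function: the increment [h *: 1] of the parameter moves
   the point by [h *: v]. *)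
have e : (fun h : R => h^-1 *: (f (p + (h *: 1 + a) *: v) - f (p + a *: v))) =
         (fun h => h^-1 *: (f (h *: v + (p + a *: v)) - f (p + a *: v))).
  apply/funext => h; congr (_ *: (f _ - _)).
  by rewrite [h *: 1]mulr1 scalerDl addrCA.
split=> -[df <-]; apply: DeriveDef; move: df;
  by rewrite /derivable /derive /comp /= e.
Qed.

(** Chain rule for a point running along a line with speed [c]. It is stated through the derivative
    along [v] alone; [c] will be [1 - 2 * t], and 1 for the geodesic itself. *)
Lemma is_derive_line_scaled {R : realType} {V : normedModType R} {f : V -> R}
    {p v : V} {c a l : R} :
  is_derive (p + (a * c) *: v) v f l ->
  is_derive a 1 (fun h : R => f (p + (h * c) *: v)) (c * l).
Proof.
move=> /is_derive_line df.
have dm : is_derive a 1 (fun h : R => h * c) c.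
  have -> : (fun h : R => h * c) = (c \*: id) by apply/funext => h; rewrite /= mulrC.
  by apply: is_derive_eq; rewrite /= [LHS]mulr1.
have := @is_derive1_comp R (fun h : R => f (p + h *: v)) (fun h => h * c) a l c df dm.
by rewrite [c * l]mulrC.
Qed.

(** * Integrals over compact intervals: rescaling, differentiation under the integral, the
    fundamental theorem *)

Section Integrals.
Variable R : realType.
Local Notation mu := (@lebesgue_measure R).

Lemma continuous_integrable_itv (a b : R) (f : R -> R) :
  {in `[a, b], continuous f} -> mu.-integrable `[a, b] (EFin \o f).
Proof.
move=> cf; apply: continuous_compact_integrable; first exact: segment_compact.
by apply: continuous_in_subspaceT => x; rewrite inE => /= xab; exact: cf.
Qed.

Lemma Rintegral_lincomb (a b k l : R) (f g : R -> R) :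
  {in `[a, b], continuous f} -> {in `[a, b], continuous g} ->
  \int[mu]_(x in `[a, b]) (k * f x + l * g x) =
  k * \int[mu]_(x in `[a, b]) f x + l * \int[mu]_(x in `[a, b]) g x.
Proof.
move=> cf cg.
have cZ (c : R) (h : R -> R) : {in `[a, b], continuous h} ->
    {in `[a, b], continuous (fun x => c * h x)}.
  by move=> ch x xab; apply: cvgM; [exact: cvg_cst | exact: ch].
rewrite RintegralD//; try exact/continuous_integrable_itv/cZ.
by rewrite !RintegralZl//; exact: continuous_integrable_itv.
Qed.

Lemma Rintegral_rescale (r : R) (f : R -> R) : 0 < r ->
  {in `[0, r], continuous f} ->
  \int[mu]_(s in `[0, r]) f s = \int[mu]_(t in `[0, 1]) (r * f (r * t)).
Proof.
move=> r0 cf; rewrite /Rintegral; congr fine.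
have D (x : R) : is_derive x 1 ( *%R r) r.
  have -> : *%R r = (r \*: id) by apply/funext.
  by apply: is_derive_eq; rewrite [LHS]mulr1.
have d1 : derive1 ( *%R r) = cst r.
  by apply/funext => x; rewrite derive1E; exact: derive_val.
have cm : continuous ( *%R r) by exact: mulrl_continuous.
have := @integration_by_substitution_increasing R ( *%R r) f 0 1 ler01.
rewrite mulr0 mulr1 d1 => ->.
- by apply: eq_integral => x _; rewrite /= mulrC.
- by move=> x y _ _ xy; rewrite ltr_pM2l.
- by move=> x _; exact: cst_continuous.
- exact: is_cvg_cst.
- exact: is_cvg_cst.
- split.
  + by move=> x _; case: (D x).
  + exact/cvg_at_right_filter/cm.
  + exact/cvg_at_left_filter/cm.
- by apply: continuous_in_subspaceT => x; rewrite inE => /= xr; exact: cf.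
Qed.

(** Dominated differentiation under the integral sign: [dG] is jointly continuous on a compact
    rectangle, hence bounded there, and a constant is an integrable dominating function on
    [[u, v]]. *)
Lemma is_derive_Rintegral (G dG : R -> R -> R) (u v c d a : R) :
  a \in `]c, d[ ->
  (forall h t, h \in `[c, d] -> t \in `[u, v] ->
     [/\ is_derive h 1 (G ^~ t) (dG h t),
         {for t, continuous (G h)} &
         {for (h, t), continuous (fun z : R * R => dG z.1 z.2)}]) ->
  is_derive a 1 (fun h => \int[mu]_(t in `[u, v]) G h t)
    (\int[mu]_(t in `[u, v]) dG a t).
Proof.
move=> acd H.
have [M [Mr HM]] : bounded_set ((fun z : R * R => dG z.1 z.2) @`
    (`[c, d] `*` `[u, v])).
  apply/compact_bounded/continuous_compact; last first.
    by apply: compact_setX; exact: segment_compact.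
  apply: continuous_in_subspaceT => -[h t]; rewrite inE => -[/= hc tu].
  by have [] := H h t hc tu.
have d1E h t : h \in `[c, d] -> t \in `[u, v] -> partial1of2 G h t = dG h t.
  move=> hc tu; rewrite partial1of2E; apply: derive_val.
  by have [] := H h t hc tu.
have cw h : h \in `]c, d[ -> h \in `[c, d] by exact: subset_itv_oo_cc.
have acd' := cw _ acd.
(* Boundedness gives the estimate for every number strictly above [M]; this one is also nonnegative,
   as a dominating function has to be. *)
pose K : R := `|M| + 1.
have B : forall x y, [set` `]c, d[] x -> [set` `[u, v]] y ->
    `|partial1of2 G x y| <= cst K y.
  move=> x y /= /cw xc yu; rewrite d1E//.
  apply: (HM K); last by exists (x, y).
  by rewrite /K (le_lt_trans (ler_norm _))// ltrDl.
have := @cvg_differentiation_under_integral R _ _ mu G `[u, v]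
  (measurable_itv _) a c d acd _ _ (cst K) _ _ B.
have -> : \int[mu]_(t in `[u, v]) partial1of2 G a t =
          \int[mu]_(t in `[u, v]) dG a t.
  by apply: eq_Rintegral => t; rewrite inE /= => tu; rewrite d1E.
move=> L.
have {}L : h^-1 *: (\int[mu]_(t in `[u, v]) G (h *: 1 + a) t -
  \int[mu]_(t in `[u, v]) G a t) @[h --> 0^'] --> \int[mu]_(t in `[u, v]) dG a t.
  under eq_fun do rewrite scaler1.
  apply: L.
  - move=> x /cw xc; apply: continuous_integrable_itv => t tu.
    by have [] := H x t xc tu.
  - by move=> x y /cw xc yu; have [[]] := H x y xc yu.
  - by move=> y; rewrite /K addr_ge0.
  - by apply: continuous_integrable_itv => t _; exact: cst_continuous.
by apply: DeriveDef; [apply/cvg_ex; eexists; exact: L | exact/cvg_lim].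
Qed.

Lemma Rintegral_derive (f F : R -> R) (a b : R) : a < b ->
  {in `[a, b], continuous f} ->
  (forall x, x \in `[a, b] -> is_derive x 1 F (f x)) ->
  \int[mu]_(x in `[a, b]) f x = F b - F a.
Proof.
move=> ab cf dF.
have cF x : x \in `[a, b] -> {for x, continuous F}.
  by move=> /dF[dFx _]; apply/differentiable_continuous/derivable1_diffP.
have aab : a \in `[a, b] by rewrite bound_itvE ltW.
have bab : b \in `[a, b] by rewrite bound_itvE ltW.
rewrite /Rintegral (@continuous_FTC2 R f F a b ab)//.
- by apply: continuous_in_subspaceT => x; rewrite inE => /= xr; exact: cf.
- split.
  + by move=> x /subset_itv_oo_cc /dF[].
  + exact/cvg_at_right_filter/cF.
  + exact/cvg_at_left_filter/cF.
- by move=> x /subset_itv_oo_cc /dF ?; rewrite derive1E; exact: derive_val.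
Qed.

End Integrals.

(** * Algebra and derivatives of the inner product, the distance and the tensor contraction *)

Section Tensors.
Variables (R : realType) (n : nat).
Implicit Types (tau : tensor_field R n) (p u v w x y : 'rV[R]_n).

Lemma dotpC u w : dotp u w = dotp w u.
Proof. by apply: eq_bigr => k _; rewrite mulrC. Qed.

Lemma dotpDl u v w : dotp (u + v) w = dotp u w + dotp v w.
Proof. by rewrite -big_split; apply: eq_bigr => k _; rewrite mxE mulrDl. Qed.

Lemma dotpZl (a : R) u w : dotp (a *: u) w = a * dotp u w.
Proof. by rewrite mulr_sumr; apply: eq_bigr => k _; rewrite mxE mulrA. Qed.

Lemma dotpDr u v w : dotp u (v + w) = dotp u v + dotp u w.
Proof. by rewrite dotpC dotpDl !(dotpC u). Qed.

Lemma dotpZr (a : R) u w : dotp u (a *: w) = a * dotp u w.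
Proof. by rewrite dotpC dotpZl dotpC. Qed.

Lemma dotp_eq0 u : (dotp u u == 0) = (u == 0).
Proof.
rewrite psumr_eq0 => [|k _]; last by rewrite -expr2 sqr_ge0.
apply/allP/eqP => [H|-> k _]; last by rewrite /= mxE mul0r eqxx.
apply/rowP => k; rewrite mxE; apply/eqP.
by have := H k (mem_index_enum k); rewrite /= mulf_eq0 orbb.
Qed.

Lemma dotp_ge0 u : 0 <= dotp u u.
Proof. by apply: sumr_ge0 => k _; rewrite -expr2 sqr_ge0. Qed.

Lemma dotp_gt0 u : (0 < dotp u u) = (u != 0).
Proof. by rewrite lt_def dotp_ge0 andbT dotp_eq0. Qed.

Lemma rdistE x y : rdist x y = enorm (y - x).
Proof.
by rewrite /rdist -opprB -scaleN1r /enorm dotpZl dotpZr !mulN1r opprK.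
Qed.

Lemma rdist_gt0 x y : (0 < rdist x y) = (x != y).
Proof. by rewrite sqrtr_gt0 dotp_gt0 subr_eq0. Qed.

Lemma rdistZNvec x y : x != y -> rdist x y *: Nvec x y = y - x.
Proof.
rewrite -rdist_gt0 /Nvec -rdistE => r0.
by rewrite scalerA divff ?scale1r// gt_eqF.
Qed.

Lemma tappZl tau p (a : R) u w : tapp tau p (a *: u) w = a * tapp tau p u w.
Proof.
rewrite mulr_sumr; apply: eq_bigr => i _; rewrite mulr_sumr.
by apply: eq_bigr => j _; rewrite mxE !mulrA.
Qed.

Lemma tappZr tau p (a : R) u w : tapp tau p u (a *: w) = a * tapp tau p u w.
Proof.
rewrite mulr_sumr; apply: eq_bigr => i _; rewrite mulr_sumr.
by apply: eq_bigr => j _; rewrite mxE; ring.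
Qed.

Lemma tapp_sym tau p u w : (forall i j, tau i j p = tau j i p) ->
  tapp tau p u w = tapp tau p w u.
Proof.
move=> sym; rewrite /tapp exchange_big; apply: eq_bigr => i _.
by apply: eq_bigr => j _; rewrite sym [u _ _ * _]mulrC.
Qed.

(** The parameter space is arbitrary because the lemma serves both for integrands in one real
    variable and for joint continuity in [(h, t)]. *)
Lemma continuous_tapp (T : topologicalType) tau (P U W : T -> 'rV[R]_n) (t : T) :
  {for t, continuous P} -> {for t, continuous U} -> {for t, continuous W} ->
  (forall i j, {for P t, continuous (tau i j)}) ->
  {for t, continuous (fun z => tapp tau (P z) (U z) (W z))}.
Proof.
move=> cP cU cW ctau.
have cc (k : 'I_n) (X : T -> 'rV[R]_n) : {for t, continuous X} ->
    {for t, continuous (fun z => X z 0 k)}.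
  move=> cX; apply: (@continuous_comp _ _ _ X (fun M : 'rV[R]_n => M 0 k)) => //.
  exact: coord_continuous.
have csum (F : 'I_n -> T -> R) : (forall i, {for t, continuous (F i)}) ->
    {for t, continuous (fun z => \sum_(i < n) F i z)}.
  move=> cF; apply: (@cvg_big _ _ _ _ _ _ _ _ _ F (F^~ t)) => [|i _].
    exact: add_continuous.
  exact: cF.
apply: (csum) => i; apply: (csum) => j.
apply: continuousM; first by apply: continuousM; exact: cc.
exact: (continuous_comp cP (ctau i j)).
Qed.

(** Product rule, component by component. The base point stays on a line of direction [v], so the
    tensor contributes [c] times its covariant derivative along [v], and each of the two arguments
    contributes its velocity [w]. *)
Lemma is_derive_tapp tau p u v w (a c : R) :
  (forall i j, derivable (tau i j) (p + (a * c) *: v) v) ->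
  is_derive a 1
    (fun h : R => tapp tau (p + (h * c) *: v) (u + h *: w) (u + h *: w))
    (c * tapp (covD v tau) (p + (a * c) *: v) (u + a *: w) (u + a *: w)
     + tapp tau (p + (a * c) *: v) w (u + a *: w)
     + tapp tau (p + (a * c) *: v) (u + a *: w) w).
Proof.
move=> dtau.
have du (k : 'I_n) : is_derive a 1 (fun h : R => (u + h *: w) 0 k) (w 0 k).
  have -> : (fun h : R => (u + h *: w) 0 k) = cst (u 0 k) + w 0 k \*: id.
    by apply/funext => h; rewrite !mxE mulrC.
  by apply: is_derive_eq; rewrite add0r [LHS]mulr1.
set P := p + (a * c) *: v; set U := u + a *: w.
have dterm (i j : 'I_n) : is_derive a 1
    (fun h : R => (u + h *: w) 0 i * (u + h *: w) 0 j * tau i j (p + (h * c) *: v))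
    (c * (U 0 i * U 0 j * covD v tau i j P) + w 0 i * U 0 j * tau i j P
      + U 0 i * w 0 j * tau i j P).
  have dt := is_derive_line_scaled (derivableP (dtau i j)).
  have := is_deriveM (is_deriveM (du i) (du j)) dt.
  move=> /(is_derive_eq) H; apply: H.
  rewrite /GRing.scale /= -/P -/U /covD !fctE -/U; ring.
have -> : (fun h : R => tapp tau (p + (h * c) *: v) (u + h *: w) (u + h *: w)) =
  \sum_(i < n) \sum_(j < n) (fun h : R =>
     (u + h *: w) 0 i * (u + h *: w) 0 j * tau i j (p + (h * c) *: v)).
  apply/funext => h; rewrite /tapp fct_sumE; apply: eq_bigr => i _.
  by rewrite fct_sumE.
apply: is_derive_eq.
rewrite /tapp mulr_sumr -!big_split; apply: eq_bigr => i _ /=.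
by rewrite mulr_sumr -!big_split; apply: eq_bigr.
Qed.

(** The difference of the endpoints becomes [(y - x) - 2 h v], so the squared distance is a
    quadratic polynomial [q] in [h]. It is positive at 0, where the square root can be
    differentiated. *)
Lemma is_derive_rdist x y v : x != y ->
  is_derive (0 : R) 1 (fun h : R => rdist (x + h *: v) (y - h *: v))
    (- 2 * dotp (Nvec x y) v).
Proof.
move=> xy; have r0 := xy; rewrite -rdist_gt0 in r0.
have D0 : 0 < dotp (y - x) (y - x) by rewrite dotp_gt0 subr_eq0 eq_sym.
pose q h : R := dotp (y - x) (y - x) - 4 * dotp (y - x) v * h
  + 4 * dotp v v * h ^+ 2.
have dq : is_derive (0 : R) 1 q (- 4 * dotp (y - x) v).
  have -> : q = cst (dotp (y - x) (y - x)) - (4 * dotp (y - x) v) \*: id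
      + (4 * dotp v v) \*: (id ^+ 2).
    by apply/funext => h; rewrite /GRing.exp /= !fctE.
  apply: is_derive_eq; rewrite /GRing.scale /=; ring.
have q0 : q 0 = dotp (y - x) (y - x) by rewrite /q; ring.
have -> : (fun h : R => rdist (x + h *: v) (y - h *: v)) = Num.sqrt \o q.
  apply/funext => h; rewrite rdistE /enorm /comp /q; congr Num.sqrt.
  have -> : y - h *: v - (x + h *: v) = (y - x) + (- 2 * h) *: v.
    by apply/rowP => k; rewrite !mxE; ring.
  move: (y - x) => D.
  by rewrite dotpDl dotpZl !dotpDr !dotpZr [dotp v D]dotpC; ring.
have ds : is_derive (q 0) 1 Num.sqrt (2 * rdist x y)^-1.
  by rewrite q0 rdistE; exact: is_derive1_sqrt.
apply: is_derive_eq (is_derive1_comp ds dq) _.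
by rewrite /Nvec dotpZl -rdistE; field; exact: lt0r_neq0.
Qed.

End Tensors.

(** * The first variation of [Etau] along [(v, - v)] *)

Section Energy.
Variables (R : realType) (n : nat) (Omega : set 'rV[R]_n).
Hypothesis convO : Defs.convex_set Omega.
Implicit Types (tau : tensor_field R n) (p u v w x y : 'rV[R]_n).
Local Notation mu := (@lebesgue_measure R).

Definition continuous_on tau :=
  forall i j p, Omega p -> {for p, continuous (tau i j)}.

(** Smoothness is used through short lists of directions only: the empty list here, [[:: v]] for the
    covariant derivative. *)
Lemma smooth_continuous_on tau : (forall i j, smooth_on Omega (tau i j)) ->
  continuous_on tau.
Proof. by move=> sm i j p Op; have [] := sm i j [::] p Op. Qed.

Lemma smooth_covD_continuous_on tau v :
  (forall i j, smooth_on Omega (tau i j)) -> continuous_on (covD v tau).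
Proof. by move=> sm i j p Op; have [] := sm i j [:: v] p Op. Qed.

Lemma smooth_derivable tau v p : (forall i j, smooth_on Omega (tau i j)) ->
  Omega p -> forall i j, derivable (tau i j) p v.
Proof. by move=> sm Op i j; have [_] := sm i j [::] p Op; exact. Qed.

Lemma segment_sub x y (t : R) : Omega x -> Omega y -> t \in `[0, 1] ->
  Omega (x + t *: (y - x)).
Proof.
move=> Ox Oy; rewrite in_itv /= => t01.
have -> : x + t *: (y - x) = (1 - t) *: x + t *: y.
  by rewrite scalerBr scalerBl scale1r addrA addrAC.
exact: convO.
Qed.

Lemma theta_rescale x y (t : R) : x != y ->
  theta (rdist x y * t) x y = x + t *: (y - x).
Proof. by move=> xy; rewrite /theta mulrC -scalerA rdistZNvec. Qed.

Lemma theta_sub x y (s : R) : Omega x -> Omega y -> x != y ->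
  s \in `[0, rdist x y] -> Omega (theta s x y).
Proof.
move=> Ox Oy xy; have r0 := xy; rewrite -rdist_gt0 in r0.
rewrite in_itv /= => /andP[s0 sr].
have -> : s = rdist x y * (s / rdist x y) by field; exact: lt0r_neq0.
rewrite theta_rescale//; apply: segment_sub => //.
by rewrite in_itv /= divr_ge0 ?(ltW r0)//= ler_pdivrMr// mul1r.
Qed.

Lemma continuous_tapp_theta tau x y u w (s : R) : continuous_on tau ->
  Omega x -> Omega y -> x != y -> s \in `[0, rdist x y] ->
  {for s, continuous (fun s : R => tapp tau (theta s x y) u w)}.
Proof.
move=> ctau Ox Oy xy sr.
apply: (@continuous_tapp R n _ tau (fun s => theta s x y) (cst u) (cst w)).
- by apply: cvgD; [exact: cvg_cst | apply: cvgZr_tmp; exact: cvg_id].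
- exact: cst_continuous.
- exact: cst_continuous.
- by move=> i j; apply: ctau; exact: theta_sub.
Qed.

(** This form has a fixed interval of integration, so that only the integrand and the prefactor vary
    with the endpoints. The substitution gives a factor [r], and passing from [N] to [y - x] in both
    slots gives [r ^- 2]. *)
Lemma EtauE tau x y : continuous_on tau -> Omega x -> Omega y -> x != y ->
  Etau tau (x, y) = (rdist x y)^-1 *
    \int[mu]_(t in `[0, 1]) tapp tau (x + t *: (y - x)) (y - x) (y - x).
Proof.
move=> ctau Ox Oy xy; have r0 := xy; rewrite -rdist_gt0 in r0.
rewrite /Etau /= Rintegral_rescale//; last first.
  by move=> s sr; exact: continuous_tapp_theta.
rewrite -RintegralZl//; last first.
  apply: continuous_integrable_itv => t t01.
  apply: (@continuous_tapp R n _ tau (fun t : R => x + t *: (y - x))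
    (cst (y - x)) (cst (y - x))).
  - by apply: cvgD; [exact: cvg_cst | apply: cvgZr_tmp; exact: cvg_id].
  - exact: cst_continuous.
  - exact: cst_continuous.
  - by move=> i j; apply: ctau; exact: segment_sub.
apply: eq_Rintegral => t _; rewrite theta_rescale//.
rewrite -(rdistZNvec _ _ _ _ xy); move: (Nvec x y) => N.
rewrite !tappZl !tappZr; field; exact: lt0r_neq0.
Qed.

Hypothesis openO : open Omega.

Lemma is_derive_Etau tau x y v :
  (forall i j, smooth_on Omega (tau i j)) ->
  (forall i j p, Omega p -> tau i j p = tau j i p) ->
  Omega x -> Omega y -> x != y ->
  is_derive (x, y) (v, - v) (Etau tau)
    (Etau (covD v tau) (x, y)
     - 2 / rdist x y * \int[mu]_(s in `[0, rdist x y])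
         (s * tapp (covD v tau) (theta s x y) (Nvec x y) (Nvec x y)
          + 2 * tapp tau (theta s x y) v (Nvec x y))
     + 2 / rdist x y * dotp (Nvec x y) v * Etau tau (x, y)).
Proof.
move=> sm sym Ox Oy xy; have r0 := xy; rewrite -rdist_gt0 in r0.
have ctau := smooth_continuous_on _ sm.
have ccov := smooth_covD_continuous_on _ v sm.
(* Both moving endpoints stay in the open set [Omega] for small [h]. Half the radius of a ball is
   taken so that a closed, hence compact, interval of parameters fits inside. *)
have [delta d0 Od] : exists2 d : R, 0 < d & forall h, h \in `[- d, d] ->
    Omega (x + h *: v) /\ Omega (y - h *: v).
  have near_line z u : Omega z -> \forall h \near (0 : R), Omega (z + h *: u).
    move=> Oz; have cz : {for (0 : R), continuous (fun h : R => z + h *: u)}.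
      by apply: cvgD; [exact: cvg_cst | apply: cvgZr_tmp; exact: cvg_id].
    by apply: cz; rewrite scale0r addr0; exact: open_nbhs_nbhs.
  have : \forall h \near (0 : R), Omega (x + h *: v) /\ Omega (y + h *: - v).
    by near=> h; split; near: h; exact: near_line.
  move=> /nbhs_ballP[e /= e0 He]; exists (e / 2); first by rewrite divr_gt0.
  move=> h; rewrite in_itv /= => /andP[h1 h2].
  have [] := He h; last by rewrite scalerN.
  rewrite /ball /= sub0r normrN (@le_lt_trans _ _ (e / 2))//.
    by rewrite ler_norml h1 h2.
  by rewrite ltr_pdivrMr// mulr2n mulrDr mulr1 ltrDl.
(* [P h t] is the point at time [t] of the segment between the moved endpoints and [U h] is their
   difference. The endpoints move by [h v] and [- h v], which gives the speed [1 - 2 * t] of [P] and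
   the velocity [w] of [U]. *)
pose D := y - x; pose w := (- 2 : R) *: v.
pose P (h t : R) := (x + t *: D) + (h * (1 - 2 * t)) *: v.
pose U (h : R) := D + h *: w.
pose G h t := tapp tau (P h t) (U h) (U h).
pose dG h t := (1 - 2 * t) * tapp (covD v tau) (P h t) (U h) (U h)
  + tapp tau (P h t) w (U h) + tapp tau (P h t) (U h) w.
have PE h t : P h t = (x + h *: v) + t *: ((y - h *: v) - (x + h *: v)).
  by apply/rowP => k; rewrite !mxE; ring.
have UE h : U h = (y - h *: v) - (x + h *: v).
  by apply/rowP => k; rewrite !mxE; ring.
have OP h t : h \in `[- delta, delta] -> t \in `[0, 1] -> Omega (P h t).
  by move=> /Od[Oxh Oyh] t01; rewrite PE; exact: segment_sub.
have cP (z : R * R) : {for z, continuous (fun z : R * R => P z.1 z.2)}.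
  apply: cvgD.
    by apply: cvgD; [exact: cvg_cst | apply: cvgZr_tmp; exact: cvg_snd].
  apply: cvgZr_tmp; apply: cvgM; first exact: cvg_fst.
  apply: cvgB; first exact: cvg_cst.
  by apply: cvgM; [exact: cvg_cst | exact: cvg_snd].
have cU (z : R * R) : {for z, continuous (fun z : R * R => U z.1)}.
  by apply: cvgD; [exact: cvg_cst | apply: cvgZr_tmp; exact: cvg_fst].
have cw (z : R * R) : {for z, continuous (fun=> w)} by exact: cst_continuous.
have dI : is_derive (0 : R) 1 (fun h => \int[mu]_(t in `[0, 1]) G h t)
    (\int[mu]_(t in `[0, 1]) dG 0 t).
  apply: (@is_derive_Rintegral R G dG 0 1 (- delta) delta).
    by rewrite in_itv /= oppr_lt0 d0.
  move=> h t hd t01; have OPht := OP h t hd t01; split.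
  - apply: is_derive_tapp; exact: smooth_derivable.
  - apply: (@continuous_comp _ _ _ (fun t => (h, t))
      (fun z : R * R => G z.1 z.2)).
      exact: (@cvg_pair _ _ _ (nbhs t) (nbhs h) (nbhs t) _ _ _ (cst h) id
        (cvg_cst _) cvg_id).
    by apply: (@continuous_tapp R n _ _ (fun z : R * R => P z.1 z.2)
        (fun z : R * R => U z.1) (fun z : R * R => U z.1));
      [exact: cP | exact: cU | exact: cU |
       move=> i j; exact: ctau].
  - apply: cvgD; first apply: cvgD.
    + apply: cvgM.
        apply: cvgB; first exact: cvg_cst.
        by apply: cvgM; [exact: cvg_cst | exact: cvg_snd].
      by apply: (@continuous_tapp R n _ _ (fun z : R * R => P z.1 z.2)
        (fun z : R * R => U z.1) (fun z : R * R => U z.1));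
      [exact: cP | exact: cU | exact: cU |
         move=> i j; exact: ccov].
    + by apply: (@continuous_tapp R n _ _ (fun z : R * R => P z.1 z.2)
        (fun=> w) (fun z : R * R => U z.1));
      [exact: cP | exact: cw | exact: cU |
         move=> i j; exact: ctau].
    + by apply: (@continuous_tapp R n _ _ (fun z : R * R => P z.1 z.2)
        (fun z : R * R => U z.1) (fun=> w));
      [exact: cP | exact: cU | exact: cw |
         move=> i j; exact: ctau].
have dr := is_derive_rdist _ _ _ _ v xy.
pose rho h := rdist (x + h *: v) (y - h *: v).
have rho0 : rho 0 = rdist x y by rewrite /rho scale0r subr0 addr0.
have rho0n0 : rho 0 != 0 by rewrite rho0 lt0r_neq0.
have rho_gt0 : \forall h \near (0 : R), 0 < rho h.
  have crho : {for (0 : R), continuous rho}.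
    by apply/differentiable_continuous/derivable1_diffP; case: dr.
  by apply: (cvgr_gt _ crho); rewrite rho0.
have I0 : \int[mu]_(t in `[0, 1]) G 0 t = rdist x y * Etau tau (x, y).
  rewrite EtauE// mulrA divff ?mul1r ?lt0r_neq0//.
  by apply: eq_Rintegral => t _; rewrite /G UE PE !scale0r !addr0 !subr0.
(* With [D = r N] and symmetry of [tau], the integrand is [r^2 (1 - 2 t)] times the derivative term
   minus [4 r] times [tau(v, N)]. Since [s = r t], the part with [- 2 t] joins the second term under
   the weight [s]. *)
have J0 : \int[mu]_(t in `[0, 1]) dG 0 t =
    rdist x y * Etau (covD v tau) (x, y)
    - 2 * \int[mu]_(s in `[0, rdist x y])
         (s * tapp (covD v tau) (theta s x y) (Nvec x y) (Nvec x y)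
          + 2 * tapp tau (theta s x y) v (Nvec x y)).
  have ca := continuous_tapp_theta _ x y (Nvec x y) (Nvec x y) _ ccov Ox Oy xy.
  have cb := continuous_tapp_theta _ x y v (Nvec x y) _ ctau Ox Oy xy.
  have cc s : s \in `[0, rdist x y] -> {for s, continuous (fun s : R =>
      s * tapp (covD v tau) (theta s x y) (Nvec x y) (Nvec x y)
      + 2 * tapp tau (theta s x y) v (Nvec x y))}.
    move=> sr; apply: cvgD; apply: cvgM.
    - exact: cvg_id.
    - exact: ca.
    - exact: cvg_cst.
    - exact: cb.
  rewrite /Etau /= -mulNr -Rintegral_lincomb// [RHS]Rintegral_rescale//; last first.
    by move=> s sr; apply: cvgD; (apply: cvgM; first exact: cvg_cst);
      [exact: ca | exact: cc].
  apply: eq_Rintegral => t; rewrite inE /= => t01.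
  rewrite /dG theta_rescale// UE PE !scale0r !addr0 !subr0.
  have := tapp_sym _ _ tau (x + t *: (y - x)) (Nvec x y) v
    (fun i j => sym i j _ (segment_sub _ _ _ Ox Oy t01)).
  rewrite -(rdistZNvec _ _ _ _ xy) /w; move: (Nvec x y) => N symN.
  by rewrite !tappZl !tappZr symN; ring.
have E0 : (x, y) = (x, y) + (0 : R) *: (v, - v) by rewrite scale0r addr0.
rewrite [X in is_derive X]E0; apply/is_derive_line.
(* The formula of [EtauE] requires distinct endpoints in [Omega], so it replaces [Etau] only for [h]
   near 0, which suffices for the derivative. *)
apply: (@near_eq_is_derive _ _ _ (fun h => (rho h)^-1 *
    \int[mu]_(t in `[0, 1]) G h t)).
  near=> h.
  have hd : h \in `[- delta, delta].
    apply: subset_itv_oo_cc; near: h; apply: near_in_itvoo.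
    by rewrite in_itv /= oppr_lt0 d0.
  have [Oxh Oyh] := Od h hd.
  have xyh : x + h *: v != y - h *: v.
    by rewrite -rdist_gt0; near: h; exact: rho_gt0.
  have -> : (x, y) + h *: (v, - v) = (x + h *: v, y - h *: v).
    by rewrite -scalerN.
  rewrite EtauE//; congr (_ * _).
  by apply: eq_Rintegral => t _; rewrite /G UE PE.
(* The derivative of the prefactor [rho^-1] produces the term with [dotp (Nvec x y) v]; the
   derivative of the integral produces the other two. *)
apply: (is_derive_eq (is_deriveM (is_deriveV (f := rho) rho0n0 dr) dI)).
rewrite I0 J0 rho0 /GRing.scale /=; field; exact: lt0r_neq0.
Unshelve. all: by end_near. Qed.

End Energy.

(** * Specialization to the directions of the adapted frame *)

Theorem theorem2p3 (R : realType) (n : nat) (Omega : set 'rV[R]_n)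
    (tau : tensor_field R n) (x0 y0 : 'rV[R]_n) (e : 'I_n -> 'rV[R]_n) :
  convex_domain Omega ->
  (forall i j, smooth_on Omega (tau i j)) ->
  (forall i j p, Omega p -> tau i j p = tau j i p) ->
  Omega x0 -> Omega y0 -> x0 != y0 ->
  (forall i j : 'I_n, dotp (e i) (e j) = (i == j)%:R) ->
  (forall i : 'I_n, val i = n.-1 -> e i = Nvec x0 y0) ->
  forall i : 'I_n,
  ((val i < n.-1)%N ->
     is_derive (x0, y0) (e i, - e i) (Etau tau)
       (Etau (covD (e i) tau) (x0, y0)
        - 2 / rdist x0 y0 *
          Rintegral (@lebesgue_measure R) `[0, rdist x0 y0]
            (fun s => s * tapp (covD (e i) tau) (theta s x0 y0) (Nvec x0 y0) (Nvec x0 y0)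
                      + 2 * tapp tau (theta s x0 y0) (e i) (Nvec x0 y0))))
  /\
  (val i = n.-1 ->
     is_derive (x0, y0) (e i, - e i) (Etau tau)
       (Etau (covD (e i) tau) (x0, y0) - 2 * tapp tau y0 (Nvec x0 y0) (Nvec x0 y0))).
Proof.
move=> [openO _ _ convO] sm sym Ox Oy xy on eN i.
have r0 := xy; rewrite -rdist_gt0 in r0.
have dE v := is_derive_Etau _ _ _ convO openO _ _ _ v sm sym Ox Oy xy.
(* The index [i] witnesses that [n] is positive, so [n.-1] is a genuine index; its frame vector is
   [N], and orthonormality can be applied to it. *)
have nlt : (n.-1 < n)%N by rewrite ltn_predL (leq_ltn_trans _ (ltn_ord i)).
have eNn := eN (Ordinal nlt) erefl.
split=> [lt_in|i_n].
  apply: is_derive_eq (dE (e i)) _; rewrite -eNn on.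
  by rewrite -val_eqE /= gtn_eqF// mulr0 mul0r addr0.
rewrite eN//; apply: is_derive_eq (dE _) _.
have -> : dotp (Nvec x0 y0) (Nvec x0 y0) = 1 by rewrite -eNn on eqxx.
set N := Nvec x0 y0; set r := rdist x0 y0.
pose g (s : R) := tapp tau (theta s x0 y0) N N.
pose dg (s : R) := tapp (covD N tau) (theta s x0 y0) N N.
have ctau := smooth_continuous_on _ _ _ _ sm.
have ccov := smooth_covD_continuous_on _ _ _ _ N sm.
have cg : {in `[0, r], continuous g}.
  by move=> s sr; exact: continuous_tapp_theta convO _ _ _ _ _ _ ctau _ _ _ _.
have cdg : {in `[0, r], continuous dg}.
  by move=> s sr; exact: continuous_tapp_theta convO _ _ _ _ _ _ ccov _ _ _ _.
have csdg : {in `[0, r], continuous (fun s : R => s * dg s + g s)}.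
  move=> s sr; apply: cvgD; last exact: cg.
  by apply: cvgM; [exact: cvg_id | exact: cdg].
(* The function [s * g s] is a primitive of [s * dg s + g s], as [dg] is the derivative of [g] along
   the unit-speed segment. *)
have dF s : s \in `[0, r] -> is_derive s 1 (id * g) (s * dg s + g s).
  move=> sr.
  have dgs : is_derive s 1 g (dg s).
    have Os := theta_sub _ _ _ convO _ _ _ Ox Oy xy sr.
    have dt := smooth_derivable _ _ _ _ N _ sm Os.
    rewrite /theta -/N -[s]mulr1 in dt.
    (* Here the arguments of the tensor are constant and the speed is 1, so [is_derive_tapp] applies
       with [w = 0] and [c = 1]. *)
    have -> : g = fun h : R =>
        tapp tau (x0 + (h * 1) *: N) (N + h *: 0) (N + h *: 0).
      by apply/funext => h; rewrite scaler0 addr0 mulr1.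
    apply: is_derive_eq (is_derive_tapp _ _ _ _ _ _ _ _ _ dt) _.
    (* The zero vector is written as a multiple of itself so that homogeneity removes the two terms
       in [w]. *)
    rewrite -(scale0r (0 : 'rV[R]_n)) tappZl tappZr !mul0r !addr0 mul1r.
    by rewrite scale0r scaler0 addr0 mulr1.
  by apply: is_derive_eq; rewrite /GRing.scale /= mulr1.
have ftc : \int[lebesgue_measure]_(s in `[0, r]) (s * dg s + g s) = r * g r.
  by rewrite (@Rintegral_derive R _ (id * g) 0 r r0 csdg dF) !fctE mul0r subr0.
(* One copy of [g] completes the total derivative and the other integrates to [Etau]. After
   multiplication by [- 2 / r], the latter cancels against the term that comes from the variation of
   the length, leaving [- 2 * g r]. *)
have -> : \int[lebesgue_measure]_(s in `[0, r]) (s * dg s + 2 * g s) =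
    r * g r + Etau tau (x0, y0).
  rewrite -ftc /Etau /= -/N -/r.
  rewrite -[X in X + _]mul1r -[X in _ + X]mul1r -Rintegral_lincomb//.
  by apply: eq_Rintegral => s _; rewrite !mul1r -addrA mulr2n mulrDl !mul1r.
have -> : tapp tau y0 N N = g r.
  rewrite /g; congr (tapp _ _ _ _).
  by rewrite -[r]mulr1 theta_rescale// scale1r addrC subrK.
field; exact: lt0r_neq0.
Qed.
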